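(* There exist a (well-formed) timed automaton game $\mathcal A$ with clock set $C$, a union of regions $Y$ of $\mathcal A$, and a state $s$ such that, for the objective of staying in $Y$ (the safety objective $\mathrm{Safe}(Y)$ consisting of runs all of whose states lie in $Y$), player 1 has no memoryless receptive region strategy that is sure winning from $s$, but player 1 has a receptive region strategy that is sure winning from $s$ and requires at most $|C|+1$ memory states.
   Context: Timed game structures. A timed game structure is $\mathcal{G}=\langle S,A_1,A_2,\Gamma_1,\Gamma_2,\delta\rangle$: $S$ states; $A_1,A_2$ disjoint action sets, $A_i^\bot=A_i\cup\{\bot_i\}$; moves of player $i$ are $M_i=\mathbb{R}_{\ge0}\times A_i^\bot$ ($\langle\Delta,a_i\rangle$: wait $\Delta$, then take $a_i$; $\bot_i$: just let time pass); $\Gamma_i(s)\subseteq M_i$ nonempty sets of available moves containing $\langle0,\bot_i\rangle$; $\delta$ a transition function compatible with splitting delays. In each round both players propose moves $\langle\Delta_1,a_1\rangle,\langle\Delta_2,a_2\rangle$; the move with the smaller delay determines the successor (ties resolved by a scheduler), and elapsed time is $\min(\Delta_1,\Delta_2)$. Player $i$ is blamed for a transition iff $\Delta_i\le\Delta_{3-i}$ and the successor is the one produced by its move. A run is time-divergent if total elapsed time tends to $\infty$; $\mathrm{Blameless}_i$ is the set of runs where player $i$ is blamed only finitely often. A strategy maps finite run prefixes to probability distributions over available moves. A strategy of player $i$ is receptive if against every opponent strategy, every resulting run is time-divergent or in $\mathrm{Blameless}_i$. A player-1 strategy is sure winning (receptive) for an objective $\Phi$ from $s$ if it is receptive and, for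 all schedulers and all receptive player-2 strategies, all outcome runs from $s$ belong to $\Phi$. A strategy with $m$ memory states is implemented with a memory set of size $m$ (move depends on current state and memory value, memory updated along the run); memoryless means a single memory state, i.e. the move depends only on the current state. Timed automaton games. $\mathcal{A}=\langle L,C,A_1,A_2,E,\gamma\rangle$: finite locations $L$, finite clocks $C$, disjoint action sets, edges $\langle l,a,\theta,l',\lambda\rangle$ with guard $\theta$ (a boolean combination of constraints $x\le d$, $d\le x$, $d\in\mathbb N$) and reset set $\lambda\subseteq C$, invariants $\gamma(l)$. States are $\langle l,\kappa\rangle$ with $\kappa:C\to\mathbb{R}_{\ge0}$ satisfying $\gamma(l)$; a player may wait $\Delta$ if the invariant holds throughout, and then take an own edge whose guard is satisfied, moving to $\langle l',(\kappa+\Delta)[\lambda:=0]\rangle$. All clocks advance at rate 1. Regions. $c_x$ is the largest constant compared with $x$ (1 if none). Valuations are region equivalent iff for clocks not exceeding $c_x$ integer parts agree, zero-ness of fractional parts agrees and the ordering of fractional parts agrees, and the set of clocks exceeding their $c_x$ is the same; a region is a class of states with the same location and equivalent valuations. A region strategy is one whose choices (probabilities of proposing a given action with delay landing in a given region) depend only on the region-equivalence class of the run prefix (the sequence of regions traversed, including during time elapse, together with the regions of the visited states). *)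

(* Defs.v *)
From Stdlib Require List.
From HB Require Import structures.
From mathcomp Require Import all_boot all_order all_algebra.
From mathcomp Require Import all_classical all_reals all_analysis.

Set Implicit Arguments.
Unset Strict Implicit.
Unset Printing Implicit Defensive.

Import Order.TTheory GRing.Theory Num.Theory.
Import numFieldNormedType.Exports.

Local Open Scope classical_set_scope.
Local Open Scope ring_scope.

Inductive player := P1 | P2.

Definition opp (i : player) : player := match i with P1 => P2 | P2 => P1 end.

(* [None] is the action "bottom" (just let time pass). Delays are required to
   be nonnegative by the availability predicate of a game structure. *)
Definition move (R : realType) (A : choiceType) : Type := (R * option A)%type.

(* Product of the Borel sigma-algebra on delays and of the discrete one on
   actions. *)
Definition move_rect (R : realType) (A : choiceType) :
    set (set (R * option A)%type) :=
  [set X | exists (B : set (measurableTypeR R)) (D : set (option A)),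
      measurable B /\ X = B `*` D].

Definition mmove (R : realType) (A : choiceType) :=
  g_sigma_algebraType (@move_rect R A).

Definition move_ball (R : realType) (A : choiceType) (m : mmove R A) (e : R) :
    set (mmove R A) :=
  [set m' : mmove R A | m'.2 = m.2 /\ `|m'.1 - m.1| < e].

(* A distribution comes with the set of the moves it can produce. When it has a
   density no single move has positive probability, and the topological support
   alone is too large (the uniform distribution on an open interval of delays
   cannot produce the endpoints), so this set is part of the data: it has
   probability one and lies inside the topological support. For a finitely
   supported distribution it is necessarily the set of the moves of positive
   probability. *)
Record dist (R : realType) (A : choiceType) := Dist {
  dprob : probability (mmove R A) R;
  dsupp : set (mmove R A);
  dsupp_measurable : measurable dsupp;
  dsupp_full : dprob dsupp = 1%E;
  dsupp_support : forall m, dsupp m -> forall e : R, 0 < e ->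
    (0 < dprob (move_ball m e))%E }.

(* The action sets of the two players are disjoint because they are distinct
   types. [trans] is only meaningful on available moves. *)
Record game (R : realType) := Game {
  state : Type;
  act : player -> choiceType;
  avail : forall i, state -> set (move R (act i));
  trans : forall i, state -> move R (act i) -> state;
  avail_ge0 : forall i s m, avail (i := i) s m -> 0 <= m.1;
  avail_bot : forall i s, avail (i := i) s (0, None);
  avail_split : forall i s (t d : R) (a : option (act i)), 0 <= t <= d ->
    avail s (d, a) <->
    avail (i := i) s (t, None) /\ avail (trans (i := i) s (t, None)) (d - t, a);
  trans_split : forall i s (t d : R) (a : option (act i)), 0 <= t <= d ->
    avail s (d, a) ->
    trans s (d, a) = trans (trans (i := i) s (t, None)) (d - t, a) }.

Arguments avail {R g} i s.
Arguments trans {R g} i s m.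

Section Play.
Context {R : realType} {G : game R}.

Definition joint := forall i, move R (act G i).

Definition elapsed (m : joint) : R := Num.min (m P1).1 (m P2).1.

Definition blame (i : player) (s : state G) (m : joint) (s' : state G) : Prop :=
  (m i).1 <= (m (opp i)).1 /\ s' = trans i s (m i).

(* A finite run prefix: initial state and successive rounds, each made of the
   two proposed moves and of the state reached. *)
Definition prefix := (state G * seq (joint * state G))%type.

Definition plast (p : prefix) : state G := last p.1 (map snd p.2).

Fixpoint valid_steps (s : state G) (w : seq (joint * state G)) : Prop :=
  match w with
  | [::] => True
  | (m, s') :: w' => [/\ forall i, avail i s (m i),
                         exists i, blame i s m s' & valid_steps s' w']
  end.

Definition valid_prefix (p : prefix) : Prop := valid_steps p.1 p.2.

Record strategy (i : player) := Strategy {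
  choice_of :> prefix -> dist R (act G i);
  choice_avail : forall p, valid_prefix p ->
    dsupp (choice_of p) `<=` avail i (plast p) }.

Definition profile := forall i, strategy i.

Definition scheduler := prefix -> joint -> player.

Definition winner (sc : scheduler) (p : prefix) (m : joint) : player :=
  if (m P1).1 < (m P2).1 then P1
  else if (m P2).1 < (m P1).1 then P2 else sc p m.

Record run := Run { rstate : nat -> state G; rmove : nat -> joint }.

Definition rprefix (r : run) (k : nat) : prefix :=
  (rstate r 0, [seq (rmove r j, rstate r j.+1) | j <- iota 0 k]).

Definition outcome (s : state G) (pr : profile) (sc : scheduler) (r : run) :=
  rstate r 0 = s /\
  forall k, (forall i, dsupp (pr i (rprefix r k)) (rmove r k i)) /\
    let w := winner sc (rprefix r k) (rmove r k) in
    rstate r k.+1 = trans w (rstate r k) (rmove r k w).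

Definition time_divergent (r : run) : Prop :=
  (fun n => \sum_(k < n) elapsed (rmove r k)) @ \oo --> +oo.

Definition blameless (i : player) (r : run) : Prop :=
  finite_set [set k | blame i (rstate r k) (rmove r k) (rstate r k.+1)].

Definition receptive (i : player) (pi : strategy i) : Prop :=
  forall (pr : profile) (sc : scheduler) (s : state G) (r : run),
    pr i = pi -> outcome s pr sc r -> time_divergent r \/ blameless i r.

Definition sure_winning (s : state G) (Phi : set run) (pi : strategy P1) :=
  receptive pi /\
  forall (pr : profile) (sc : scheduler) (r : run),
    pr P1 = pi -> receptive (pr P2) -> outcome s pr sc r -> Phi r.

(* The states of a run are its initial state and those reached by its rounds,
   not the configurations passed through while time elapses. *)
Definition safe (Y : set (state G)) : set run :=
  [set r | forall k, Y (rstate r k)].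

(* The last state of the prefix has not been read yet: the move depends on the
   memory value returned here together with that state. *)
Fixpoint memory (M : Type) (upd : M -> state G -> M) (m : M) (s : state G)
    (w : seq (joint * state G)) : M :=
  match w with
  | [::] => m
  | (_, s') :: w' => memory upd (upd m s) s' w'
  end.

Definition has_memory (n : nat) (i : player) (pi : strategy i) : Prop :=
  exists (M : finType) (m0 : M) (upd : M -> state G -> M)
         (next : M -> state G -> dist R (act G i)),
    #|M| = n /\
    forall p, valid_prefix p ->
      pi p = next (memory upd m0 p.1 p.2) (plast p).

Definition memoryless (i : player) (pi : strategy i) := has_memory 1 pi.

End Play.

Arguments joint {R} G.
Arguments prefix {R} G.
Arguments strategy {R} G i.
Arguments profile {R} G.
Arguments scheduler {R} G.
Arguments run {R} G.

Definition well_formed (R : realType) (G : game R) : Prop :=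
  forall i, exists pi : strategy G i, receptive pi.

Inductive constr (C : Type) :=
  | CTrue
  | CLe of C & nat
  | CGe of C & nat
  | CNot of constr C
  | CAnd of constr C & constr C.

Arguments CTrue {C}.

Fixpoint sat (R : realType) (C : finType) (th : constr C)
    (kap : {ffun C -> R}) : bool :=
  match th with
  | CTrue => true
  | CLe x d => kap x <= d%:R
  | CGe x d => d%:R <= kap x
  | CNot t => ~~ sat t kap
  | CAnd t u => sat t kap && sat u kap
  end.

Fixpoint consts (C : finType) (x : C) (th : constr C) : seq nat :=
  match th with
  | CTrue => [::]
  | CLe y d | CGe y d => if y == x then [:: d] else [::]
  | CNot t => consts x t
  | CAnd t u => consts x t ++ consts x u
  end.

Record edge (L C : finType) (A : choiceType) := Edge {
  esrc : L; elab : A; eguard : constr C; edst : L; ereset : {set C} }.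

Definition inj_act (A : player -> choiceType) (i : player) :
    A i -> (A P1 + A P2)%type :=
  match i with P1 => inl | P2 => inr end.

(* Two different edges from the same location with the same label have
   incompatible guards, so that a state and a move determine the successor. *)
Record automaton (R : realType) := Automaton {
  loc : finType;
  clock : finType;
  action : player -> choiceType;
  edges : seq (edge loc clock (action P1 + action P2)%type);
  inv : loc -> constr clock;
  edges_det : forall e e', List.In e edges -> List.In e' edges ->
    esrc e = esrc e' -> elab e = elab e' -> e <> e' ->
    forall kap : {ffun clock -> R}, (forall x, 0 <= kap x) ->
      ~ (sat (eguard e) kap /\ sat (eguard e') kap) }.

Section Semantics.
Context {R : realType} (A : automaton R).
Local Notation L := (loc A).
Local Notation C := (clock A).
Local Notation val_ := {ffun C -> R}.
Local Notation conf := (L * val_)%type.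

Definition is_state (q : conf) : bool :=
  [forall x, 0 <= q.2 x] && sat (inv q.1) q.2.

Definition astate := {q : conf | is_state q}.

Definition delay (kap : val_) (t : R) : val_ := [ffun x => kap x + t].

Definition reset (kap : val_) (X : {set C}) : val_ :=
  [ffun x => if x \in X then 0 else kap x].

Definition wait (q : conf) (t : R) : conf := (q.1, delay q.2 t).

Definition target (e : edge L C (action A P1 + action A P2)%type) (q : conf) :
    conf := (edst e, reset q.2 (ereset e)).

Definition enabled (i : player) (q : conf) (a : action A i)
    (e : edge L C (action A P1 + action A P2)%type) : bool :=
  [&& esrc e == q.1, elab e == inj_act a, sat (eguard e) q.2
    & is_state (target e q)].

Definition aavail (i : player) (s : astate) : set (move R (action A i)) :=
  [set m | [/\ 0 <= m.1,
     forall t, 0 <= t <= m.1 -> is_state (wait (val s) t) &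
     match m.2 with
     | None => True
     | Some a => has (enabled (wait (val s) m.1) a) (edges A)
     end]].

(* Out of [aavail], the value is irrelevant. *)
Definition atrans (i : player) (s : astate) (m : move R (action A i)) :
    astate :=
  let q := wait (val s) m.1 in
  match m.2 with
  | None => insubd s q
  | Some a =>
      if seq.filter (enabled q a) (edges A) is e :: _ then insubd s (target e q)
      else s
  end.

Lemma waitD q t u : wait (wait q t) u = wait q (t + u).
Proof.
by rewrite /wait; congr pair; apply/ffunP => x; rewrite !ffunE addrA.
Qed.

Lemma wait0 q : wait q 0 = q.
Proof.
by case: q => l k; rewrite /wait; congr pair; apply/ffunP => x; rewrite ffunE addr0.
Qed.

Lemma val_wait i (s : astate) t : aavail (i := i) s (t, None) ->
  val (atrans (i := i) s (t, None)) = wait (val s) t.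
Proof.
move=> [/= t0 H _]; rewrite /atrans /= val_insubd H //.
by rewrite t0 lexx.
Qed.

Lemma aavail_ge0 i s m : aavail (i := i) s m -> 0 <= m.1.
Proof. by case. Qed.

Lemma aavail_bot i s : aavail (i := i) s (0, None).
Proof.
split=> //= t /andP[t0 t0']; have -> : t = 0 by apply/le_anti; rewrite t0 t0'.
by rewrite wait0; exact: (valP s).
Qed.

Lemma aavail_split i s (t d : R) (a : option (action A i)) : 0 <= t <= d ->
  aavail s (d, a) <->
  aavail (i := i) s (t, None) /\
  aavail (atrans (i := i) s (t, None)) (d - t, a).
Proof.
move=> /andP[t0 td]; split.
- move=> [/= d0 H1 H2].
  have At : aavail (i := i) s (t, None).
    split=> //= u /andP[u0 ut]; apply: H1.
    by rewrite u0 (le_trans ut td).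
  split=> //; split => /=.
  + by rewrite subr_ge0.
  + move=> u /andP[u0 ud]; rewrite val_wait // waitD; apply: H1.
    by rewrite addr_ge0 // addrC -lerBrDr.
  + by rewrite val_wait // waitD addrCA subrr addr0.
- move=> [At [/= d0 H1 H2]]; case: (At) => /= _ H3 _.
  rewrite val_wait // in H1 H2.
  split=> /=.
  + exact: le_trans t0 td.
  + move=> u /andP[u0 ud]; case: (lerP u t) => ut; first by apply: H3; rewrite u0.
    have := H1 (u - t); rewrite waitD addrCA subrr addr0; apply.
    by rewrite subr_ge0 (ltW ut) lerD2r.
  + by rewrite waitD addrCA subrr addr0 in H2.
Qed.

Lemma atrans_split i s (t d : R) (a : option (action A i)) : 0 <= t <= d ->
  aavail s (d, a) ->
  atrans s (d, a) = atrans (atrans (i := i) s (t, None)) (d - t, a).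
Proof.
move=> td Ad; have [At [/= _ H1 _]] := (aavail_split s a td).1 Ad.
case: Ad => /= d0 H2 H3.
have E : wait (val (atrans (i := i) s (t, None))) (d - t) = wait (val s) d.
  by rewrite val_wait // waitD addrCA subrr addr0.
have Sd : is_state (wait (val s) d) by apply: H2; rewrite d0 lexx.
apply: val_inj; rewrite {1}/atrans [in RHS]/atrans [_.1]/= [_.2]/= [(_, a).1]/= E.
case: a H3 {H1} => [a|] H3; last by rewrite !val_insubd Sd.
move: H3 => /=; rewrite has_count -size_filter.
case F: (seq.filter _ _) => [//|e w] _.
have /andP[] : all (enabled (wait (val s) d) a) (e :: w) by rewrite -F filter_all.
by case/and4P=> _ _ _ St _; rewrite !val_insubd St.
Qed.

Definition agame : game R :=
  Game aavail_ge0 aavail_bot aavail_split atrans_split.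

Definition all_consts (x : C) : seq nat :=
  flatten [seq consts x (eguard e) | e <- edges A] ++
  flatten [seq consts x (inv l) | l <- enum L].

Definition cmax (x : C) : nat :=
  if all_consts x is [::] then 1%N else (\max_(d <- all_consts x) d)%N.

Definition frac (r : R) : R := r - (Num.floor r)%:~R.

Definition region_eq (q q' : conf) : Prop :=
  [/\ q.1 = q'.1,
      forall x, (q.2 x > (cmax x)%:R) = (q'.2 x > (cmax x)%:R),
      forall x, q.2 x <= (cmax x)%:R ->
        Num.floor (q.2 x) = Num.floor (q'.2 x) /\
        (frac (q.2 x) == 0) = (frac (q'.2 x) == 0) &
      forall x y, q.2 x <= (cmax x)%:R -> q.2 y <= (cmax y)%:R ->
        (frac (q.2 x) <= frac (q.2 y)) = (frac (q'.2 x) <= frac (q'.2 y))].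

Definition region (q : conf) : set conf :=
  [set q' | is_state q' /\ region_eq q q'].

Definition is_region (Q : set conf) : Prop :=
  exists2 q, is_state q & Q = region q.

Definition region_union (Y : set astate) : Prop :=
  exists2 Z : set (set conf), Z `<=` is_region &
    Y = [set s | (\bigcup_(Q in Z) Q) (val s)].

(* Regions are visited during a delay in an order determined by the first one,
   and each of them during an interval of time, so the set of these regions
   determines their sequence. *)
Definition traversed (s : astate) (d : R) : set (set conf) :=
  [set region (wait (val s) t) | t in [set t | 0 <= t <= d]].

Fixpoint steps_eq (s s' : astate) (w w' : seq (joint agame * astate)) : Prop :=
  match w, w' with
  | [::], [::] => True
  | (m, t) :: v, (m', t') :: v' =>
      [/\ traversed s (elapsed m) = traversed s' (elapsed m'),
          region_eq (val t) (val t') & steps_eq t t' v v']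
  | _, _ => False
  end.

Definition prefix_eq (p p' : prefix agame) : Prop :=
  region_eq (val p.1) (val p'.1) /\ steps_eq p.1 p'.1 p.2 p'.2.

Definition landing (i : player) (s : astate) (a : option (action A i))
    (Q : set conf) : set (mmove R (action A i)) :=
  [set m : mmove R (action A i) | m.2 = a /\ Q (wait (val s) m.1)].

Definition region_strategy (i : player) (pi : strategy agame i) : Prop :=
  forall p p' : prefix agame, valid_prefix p -> valid_prefix p' ->
    prefix_eq p p' ->
    forall (a : option (action A i)) (Q : set conf), is_region Q ->
      dprob (pi p) (landing (plast p) a Q) =
      dprob (pi p') (landing (plast p') a Q).

End Semantics.

(* Main.v *)
Require Import Defs.
From mathcomp Require Import all_boot all_order all_algebra.
From mathcomp Require Import all_classical all_reals all_analysis.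
From mathcomp Require Import lra.

(** A location "busy" carries the invariant [y < 1]; there player 1 can either
    [loop], which resets the flag clock [x], or [leave] to the location "idle",
    which resets [y] but is possible only as long as [x = 0].  From "idle",
    player 2 can send the play back to "busy" as soon as [y > 0], with [x]
    reset.  All states of "busy" with [x = 0 < y < 1] form one region.
    A memoryless region strategy that may leave in this region may do so on
    each visit: player 2 sends the play back after geometrically decreasing
    delays, and time converges although player 1 is blamed again and again.
    A strategy that never leaves in this region never resets [y], and time is
    bounded by 1.  With one bit of memory, player 1 first waits and loops until
    [y >= 1/2] and only then leaves, so that a return to "busy" costs at least
    1/2 time units.  Every state is safe: receptiveness alone requires memory. *)

Set Implicit Arguments.
Unset Strict Implicit.
Unset Printing Implicit Defensive.

Import Order.TTheory GRing.Theory Num.Theory.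
Import numFieldNormedType.Exports.

Local Open Scope classical_set_scope.
Local Open Scope ring_scope.

(** * Point masses, runs and regions *)

Lemma has_filter_cons (T : Type) (p : pred T) (s : seq T) : has p s ->
  exists e w, [/\ List.In e s, p e & seq.filter p s = e :: w].
Proof.
elim: s => //= e s IH; case pe: (p e) => /=; last first.
  move=> h; have [f [w [fs pf ->]]] := IH h.
  by exists f, w; split=> //; right.
by exists e, (seq.filter p s); split=> //; left.
Qed.

Lemma infinite_often (B : nat -> Prop) : ~ finite_set [set k | B k] ->
  forall n, exists2 k, (n <= k)%N & B k.
Proof.
move=> inf n; apply: contrapT => h; apply: inf.
apply: (@sub_finite_set _ _ `I_n); last exact: finite_II.
move=> k /= Bk; rewrite ltnNge; apply/negP => nk; apply: h; by exists k.
Qed.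

(** From [n] on, [P] propagates and excludes [B], so [P n] would end the recurrence of [B]. Phases
    of a run in which a player can no longer be blamed are excluded this way. *)
Lemma not_trapped (B P : nat -> Prop) (n : nat) :
  (forall n, exists2 k, (n <= k)%N & B k) ->
  (forall k, (n <= k)%N -> P k -> ~ B k /\ P k.+1) -> ~ P n.
Proof.
move=> inf h Pn; have [k nk Bk] := inf n.
have Pk : P k.
  elim: k nk {Bk} => [|k IH]; first by rewrite leqn0 => /eqP n0; rewrite -n0.
  rewrite leq_eqVlt => /predU1P[<- //|]; rewrite ltnS => nk.
  by have [] := h k nk (IH nk).
by have [] := h k nk Pk.
Qed.

(** [S] and its image under the predecessor together cover all naturals. This serves where blame
    falls at least once in any two rounds. *)
Lemma recurrent_infinite (S : set nat) :
  (forall k, S k \/ S k.+1) -> ~ finite_set S.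
Proof.
move=> h fS; apply: infinite_nat.
apply: (@sub_finite_set _ _ (S `|` predn @` S)).
  by move=> k _; have [Sk|Sk] := h k; [left|right; exists k.+1].
by rewrite finite_setU; split=> //; exact: finite_image.
Qed.

(** * Point masses and moves of positive probability *)

Section PointMass.
Context {R : realType} {A : choiceType}.

Lemma measurable_move1 (m : mmove R A) : measurable [set m].
Proof.
apply: sub_sigma_algebra; exists [set m.1], [set m.2]; split.
  exact: measurable_set1.
apply/seteqP; split=> [[t a] -> //|[t a] /= [-> ->]].
by case: m.
Qed.

Lemma dirac_full (m : mmove R A) : (\d_m [set m] = 1 :> \bar R)%E.
Proof. by rewrite diracE in_set1 eqxx. Qed.

Lemma dirac_support (m : mmove R A) m' : [set m] m' -> forall e : R, 0 < e ->
  (0 < (\d_m : set (mmove R A) -> \bar R) (move_ball m' e))%E.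
Proof.
move=> -> e e0; rewrite diracE mem_set ?lte01 //=.
by split=> //; rewrite subrr normr0.
Qed.

Definition point_mass (m : mmove R A) : dist R A :=
  @Dist R A \d_m [set m] (measurable_move1 m) (dirac_full m) (@dirac_support m).

(** A set that misses [dsupp D] lies in a null set. Positive probability thus provides a move that
    can occur in an outcome. *)
Lemma dist_meet (D : dist R A) (X : set (mmove R A)) : measurable X ->
  (0 < dprob D X)%E -> exists2 m, dsupp D m & X m.
Proof.
move=> mX pX; have mD := dsupp_measurable D.
apply: contrapT => h; have XD : X `<=` ~` dsupp D.
  by move=> m Xm Dm; apply: h; exists m.
move: pX; rewrite ltNge => /negP; apply.
have -> : (0 = dprob D (~` dsupp D) :> \bar R)%E.
  by rewrite probability_setC // dsupp_full subee.
by apply: le_measure => //; rewrite inE //; exact: measurableC.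
Qed.

End PointMass.

(** * Elapsed time, prefixes and outcomes *)

Section Runs.
Context {R : realType} {G : game R}.
Implicit Types (r : run G) (p : Defs.prefix G).

Definition time r n : R := \sum_(k < n) elapsed (rmove r k).

Lemma timeS r n : time r n.+1 = time r n + elapsed (rmove r n).
Proof. by rewrite /time big_ord_recr. Qed.

Lemma bounded_not_divergent r (c : R) :
  (forall n, time r n <= c) -> ~ time_divergent r.
Proof.
move=> h /cvgryPgt /(_ c)[n _ /(_ n (leqnn n))] /=.
by rewrite ltNge h.
Qed.

Lemma time_nondecreasing r : (forall k, 0 <= elapsed (rmove r k)) ->
  {homo time r : m n / (m <= n)%N >-> m <= n}.
Proof.
move=> h0; apply: homo_leq => [x|x y z|n]; [exact: lexx|exact: le_trans|].
by rewrite timeS lerDl.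
Qed.

(** Elapsed time is monotone, so without divergence it converges, and a tail lies within [e] of the
    limit. *)
Lemma not_divergent_tail r (e : R) :
  (forall k, 0 <= elapsed (rmove r k)) -> ~ time_divergent r -> 0 < e ->
  exists K, forall n m, (K <= n)%N -> time r m < time r n + e.
Proof.
move=> h0 nd e0; have nt := time_nondecreasing h0.
have ct : cvgn (time r).
  by apply: contrapT => nc; apply: nd; exact: nondecreasing_dvgn_lt nt nc.
have /cvgrPdist_lt /(_ e e0)[K _ hK] := ct.
exists K => n m Kn.
have h1 := nondecreasing_cvgn_le nt ct m.
have := hK n Kn; rewrite /= ltr_norml => /andP[_ h2]; lra.
Qed.

Definition pure_strategy i (f : Defs.prefix G -> move R (act G i))
    (h : forall p, avail i (plast p) (f p)) : strategy G i :=
  @Strategy R G i (fun p => point_mass (f p : mmove R (act G i)))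
    (fun p _ m (e : m = f p) => eq_ind_r _ (h p) e).

Lemma plast_rprefix r k : plast (rprefix r k) = rstate r k.
Proof.
rewrite /plast /rprefix /=; case: k => [//|k].
by rewrite -[in iota _ _]addn1 iotaD !map_cat last_cat /= add0n.
Qed.

Lemma rprefixS r k :
  rprefix r k.+1 =
  ((rprefix r k).1, rcons (rprefix r k).2 (rmove r k, rstate r k.+1)).
Proof. by rewrite /rprefix -addn1 iotaD map_cat cats1 addn1 /= add0n. Qed.

Lemma valid_steps_rcons (s : state G) w m s' :
  valid_steps s (rcons w (m, s')) <->
  [/\ valid_steps s w, forall i, avail i (plast (s, w)) (m i) &
       exists i, blame i (plast (s, w)) m s'].
Proof.
elim: w s => [|[m1 s1] w IH] s /=; first by split=> [[]|[]].
by split=> [[h1 h2 /IH[h3 h4 h5]]|[[h1 h2 h3] h4 h5]]; split=> //; apply/IH.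
Qed.

Lemma valid_prefix_rcons p m s' : valid_prefix p ->
  (forall i, avail i (plast p) (m i)) -> (exists i, blame i (plast p) m s') ->
  valid_prefix (p.1, rcons p.2 (m, s')).
Proof.
by case: p => s w vp h1 h2; apply/valid_steps_rcons.
Qed.

Lemma elapsed_le (m : joint G) i : elapsed m <= (m i).1.
Proof. by case: i; rewrite ge_min lexx ?orbT. Qed.

Lemma winner_blame sc p (s : state G) (m : joint G) :
  blame (winner sc p m) s m (trans (winner sc p m) s (m (winner sc p m))).
Proof.
split=> //; rewrite /winner; case: ltP => [/ltW //|h].
by case: ltP => [/ltW //|h']; case: (sc p m).
Qed.

Lemma blame_elapsed i (s : state G) (m : joint G) s' :
  blame i s m s' -> elapsed m = (m i).1.
Proof.
case=> h _; rewrite /elapsed.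
by case: i h => /= h; [apply/min_idPl|apply/min_idPr].
Qed.

Lemma memory_rcons (M : Type) (u : M -> state G -> M) m s w mv s' :
  memory u m s (rcons w (mv, s')) = u (memory u m s w) (plast (s, w)).
Proof. by elim: w m s => //= -[mv1 s1] w IH m s; rewrite IH. Qed.

Section Outcome.
Context {s : state G} {pr : profile G} {sc : scheduler G} {r : run G}.
Hypothesis out : outcome s pr sc r.

Lemma outcome_valid k : valid_prefix (rprefix r k).
Proof.
have [_ h] := out; elim: k => [//|k IH].
rewrite rprefixS; apply: valid_prefix_rcons => //.
  by move=> i; apply: (choice_avail IH); exact: (h k).1.
by rewrite plast_rprefix (h k).2; eexists; exact: winner_blame.
Qed.

Lemma outcome_avail k i : avail i (rstate r k) (rmove r k i).
Proof.
rewrite -plast_rprefix; apply: (choice_avail (outcome_valid k)).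
exact: (out.2 k).1.
Qed.

Lemma outcome_blame k :
  exists i, blame i (rstate r k) (rmove r k) (rstate r k.+1).
Proof.
exists (winner sc (rprefix r k) (rmove r k)).
by rewrite (out.2 k).2; exact: winner_blame.
Qed.

Lemma outcome_elapsed k : 0 <= elapsed (rmove r k).
Proof. by rewrite le_min !(avail_ge0 (outcome_avail k _)). Qed.

Lemma outcome_pure i f h : pr i = @pure_strategy i f h ->
  forall k, rmove r k i = f (rprefix r k).
Proof. by move=> e k; have := (out.2 k).1 i; rewrite e. Qed.

End Outcome.
End Runs.

(** * Region equivalence *)

Section RegionEquivalence.
Context {R : realType}.

Lemma region_eq_sym (A : automaton R) q q' :
  @region_eq R A q q' -> region_eq q' q.
Proof.
move=> [h1 h2 h3 h4].
have le x : (q.2 x <= (cmax x)%:R) = (q'.2 x <= (cmax x)%:R).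
  by rewrite !leNgt h2.
split=> // [x|x y]; rewrite -le; first by case/h3.
by rewrite -le => hx hy; rewrite h4.
Qed.

Lemma region_eq_trans (A : automaton R) q1 q2 q3 :
  @region_eq R A q1 q2 -> region_eq q2 q3 -> region_eq q1 q3.
Proof.
move=> [h1 h2 h3 h4] [g1 g2 g3 g4].
have le x : (q1.2 x <= (cmax x)%:R) = (q2.2 x <= (cmax x)%:R).
  by rewrite !leNgt h2.
split=> [|x|x hx|x y hx hy]; [by rewrite h1|by rewrite h2| |].
  have [-> ->] := h3 x hx; apply: g3; by rewrite -le.
by rewrite h4 // g4 // -le.
Qed.

Lemma setT_region_union (A : automaton R) : region_union (A := A) setT.
Proof.
exists (@is_region R A) => //; apply/seteqP; split=> // s _ /=.
exists (region (val s)); first by exists (val s) => //; exact: (valP s).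
by split=> //; exact: (valP s).
Qed.

End RegionEquivalence.

(** * The game *)

(** Locations, clocks and actions are all booleans; [loop] and [leave] belong to
    player 1, [back] and [eject] to player 2.  For both players, [true] leads to
    "busy" and resets [x], [false] leads to "idle" and resets [y].  Without
    [eject] player 2 would have no receptive strategy, because player 1 could
    refuse to leave "busy". *)
Local Notation busy := true (only parsing).
Local Notation idle := false (only parsing).
Local Notation cx := true (only parsing).
Local Notation cy := false (only parsing).
Local Notation loop := true (only parsing).
Local Notation leave := false (only parsing).
Local Notation back := true (only parsing).
Local Notation eject := false (only parsing).

Definition arena_edges : seq (edge bool bool (bool + bool)%type) :=
  [:: Edge busy (inl loop) CTrue busy [set cx];
      Edge busy (inl leave) (CLe cx 0) idle [set cy];
      Edge idle (inr back) (CNot (CLe cy 0)) busy [set cx];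
      Edge busy (inr eject) CTrue idle [set cy]].

Definition arena_inv (l : bool) : constr bool :=
  if l == busy then CNot (CGe cy 1) else CTrue.

Section Arena.
Context {R : realType}.

Lemma arena_det (e e' : edge bool bool (bool + bool)%type) :
  List.In e arena_edges -> List.In e' arena_edges ->
  esrc e = esrc e' -> elab e = elab e' -> e <> e' ->
  forall kap : {ffun bool -> R}, (forall x, 0 <= kap x) ->
    ~ (sat (eguard e) kap /\ sat (eguard e') kap).
Proof. by move=> [<-|[<-|[<-|[<-|[]]]]] [<-|[<-|[<-|[<-|[]]]]]. Qed.

Definition arena : automaton R :=
  @Automaton R bool bool (fun=> bool) arena_edges arena_inv arena_det.

Local Notation G := (agame arena).

Definition lc (s : state G) : bool := (val s).1.
Definition vx (s : state G) : R := (val s).2 cx.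
Definition vy (s : state G) : R := (val s).2 cy.

Lemma is_stateE (q : loc arena * {ffun clock arena -> R}) :
  is_state q = [&& 0 <= q.2 cx, 0 <= q.2 cy & (q.1 == busy) ==> (q.2 cy < 1)].
Proof.
rewrite /is_state; apply/andP/and3P => [[/forallP p i]|[p1 p2 p3]].
  split; [exact: p|exact: p|].
  by apply/implyP => /eqP e; move: i; rewrite e /= ltNge.
split; first by apply/forallP; case.
by move: p3; case: (q.1) => //=; rewrite ltNge.
Qed.

Lemma state_ge0 (s : state G) : 0 <= vx s /\ 0 <= vy s.
Proof. by have := valP s; rewrite is_stateE => /and3P[]. Qed.

Lemma state_lt1 (s : state G) : lc s = busy -> vy s < 1.
Proof.
have := valP s; rewrite is_stateE => /and3P[_ _ /implyP h] e.
by apply: h; apply/eqP.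
Qed.

Lemma avail_delay i (s : state G) (t : R) :
  avail i s (t, None) <-> 0 <= t /\ (lc s = busy -> vy s + t < 1).
Proof.
have [x0 y0] := state_ge0 s.
split=> [[/= t0 h _]|[t0 h]].
  split=> // e; have := h t; rewrite lexx t0 => /(_ isT).
  by rewrite is_stateE !ffunE => /and3P[_ _ /implyP]; apply; apply/eqP.
split=> //= u /andP[u0 ut]; rewrite is_stateE /= !ffunE.
apply/and3P; split; [exact: addr_ge0|exact: addr_ge0|].
apply/implyP => /eqP /h hh; apply: le_lt_trans hh; exact: lerD.
Qed.

Lemma avail_weak i (s : state G) m : avail i s m -> avail i s (m.1, None).
Proof. by case. Qed.

Lemma avail_opp i j (s : state G) t :
  avail i s (t, None) -> avail j s (t, None).
Proof. by rewrite !avail_delay. Qed.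

Definition state_is (s : state G) l x y := [/\ lc s = l, vx s = x & vy s = y].

Lemma trans_none i (s : state G) (t : R) : avail i s (t, None) ->
  state_is (trans i s (t, None)) (lc s) (vx s + t) (vy s + t).
Proof. by move=> /val_wait h; rewrite /state_is /lc /vx /vy h /= !ffunE. Qed.

Lemma avail1 (s : state G) (t : R) (a : bool) :
  avail P1 s (t, Some a) <->
  [/\ avail P1 s (t, None), lc s = busy & a = leave -> vx s + t <= 0].
Proof.
have [x0 y0] := state_ge0 s.
split.
  move=> h; have hn : avail P1 s (t, None) := avail_weak h.
  case: h => _ _ /= h; split=> // {hn}.
    by case: a h; rewrite /enabled /= !orbF ?andbF ?orbF => /and3P[/eqP/esym].
  move=> a0; move: h; rewrite a0 /enabled /= !andbF !orbF.
  by case/and4P => _ + _ _; rewrite /= ffunE.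
move=> [hn hl ha]; split; [by case: hn|by case: hn|].
have [/= t0 hy] := (avail_delay _ _ _).1 hn.
rewrite /= /enabled /= ?is_stateE /= !ffunE !inE /=.
case: a ha => ha; rewrite ?orbF ?andbF -/(lc s) hl /=.
  by rewrite lexx !addr_ge0 //= hy.
by rewrite ha // lexx addr_ge0 //=.
Qed.

(** For [back], positivity is the guard, and the bound 1 is the invariant of the target [busy],
    because only [x] is reset. *)
Lemma avail2 (s : state G) (t : R) (a : bool) :
  avail P2 s (t, Some a) <->
  avail P2 s (t, None) /\
  (if a then [/\ lc s = idle, 0 < vy s + t & vy s + t < 1] else lc s = busy).
Proof.
have [x0 y0] := state_ge0 s.
split.
  move=> h; have hn : avail P2 s (t, None) := avail_weak h.
  split=> //; case: h => _ _ /=.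
  case: a; rewrite /enabled /= ?is_stateE /= !ffunE !inE /= ?orbF ?andbF ?orbF /=.
    by case/and5P => /eqP/esym hl; rewrite -ltNge.
  by case/and4P => /eqP/esym.
move=> [hn hl]; split; [by case: hn|by case: hn|].
have [/= t0 hy] := (avail_delay _ _ _).1 hn.
rewrite /= /enabled /= ?is_stateE /= !ffunE !inE /=.
case: a hl => [[hl h1 h2]|hl]; rewrite ?orbF ?andbF -/(lc s) hl /=.
  by rewrite -ltNge h1 h2 lexx ltW.
by rewrite lexx addr_ge0.
Qed.

Lemma trans_edge i (s : state G) (t : R) (a : bool) :
  avail i s (t, Some a) ->
  exists e, [/\ List.In e arena_edges, elab e = inj_act (a : action arena i) &
    val (trans i s (t, Some a)) = @target R arena e (wait (val s) t)].
Proof.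
case=> _ _ h.
have [e [w [ein een ew]]] :=
  @has_filter_cons _ (@enabled R arena i (wait (val s) t) a) arena_edges h.
exists e.
case/and4P: een => _ /eqP el _ st; split=> //.
have -> : trans i s (t, Some a) =
    if seq.filter (@enabled R arena i (wait (val s) t) a) arena_edges is e' :: _
    then insubd s (@target R arena e' (wait (val s) t)) else s by [].
by rewrite ew val_insubd st.
Qed.

Lemma trans_some i (s : state G) (t : R) (a : bool) :
  avail i s (t, Some a) ->
  if a then state_is (trans i s (t, Some a)) busy 0 (vy s + t)
  else state_is (trans i s (t, Some a)) idle (vx s + t) 0.
Proof.
move=> /trans_edge[e [ein el st]]; rewrite /state_is /lc /vx /vy {}st.
by case: i ein el => -[<-|[<-|[<-|[<-|[]]]]] //= [<-]; rewrite /= !ffunE !inE.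
Qed.

End Arena.

(** * A winning strategy with one bit of memory *)

Section Win.
Context {R : realType}.
Local Notation G := (agame (@arena R)).
Implicit Types (s : state G).

(** The bit is set once the play has been in "busy" with [x > 0] since its last
    visit to "idle": it then is time to leave. *)
Definition win_update (m : bool) (s : state G) : bool :=
  if lc s then (0 < vx s) || m else false.

(** Waiting half of the remaining time brings [y] to (1 + y)/2, which is at least 1/2 and respects
    the invariant. The delay 2 in [idle] carries [y] beyond its largest constant 1, so the landing
    region does not depend on [y]. *)
Definition win_next (m : bool) (s : state G) : move R (act G P1) :=
  if lc s then
    if 0 < vx s then ((1 - vy s) / 2, Some loop)
    else if m then (0, Some leave) else ((1 - vy s) / 2, None)
  else (2, None).

Lemma win_next_avail m s : avail P1 s (win_next m s).
Proof.
rewrite /win_next; have [x0 y0] := state_ge0 s; have y1 := @state_lt1 _ s.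
case: ifPn => l; last first.
  apply/avail_delay; split; first lra.
  by move=> l'; rewrite l' in l.
case: ifPn => x.
  apply/avail1; split => //; apply/avail_delay; split; have := y1 l; lra.
case: ifPn => _.
  apply/avail1; split=> //; last by move: x; rewrite -leNgt addr0.
  apply/avail_delay; split; have := y1 l; lra.
apply/avail_delay; split; have := y1 l; lra.
Qed.

Definition win : strategy G P1 :=
  pure_strategy
    (fun p => win_next_avail (memory win_update false p.1 p.2) (plast p)).

Definition win_mem (r : run G) k :=
  memory win_update false (rprefix r k).1 (rprefix r k).2.

Lemma win_memS (r : run G) k :
  win_mem r k.+1 = win_update (win_mem r k) (rstate r k).
Proof. by rewrite /win_mem rprefixS memory_rcons -(plast_rprefix r k). Qed.

Lemma win_memory : has_memory 2 win.
Proof.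
exists bool, false, win_update.
exists (fun m s => point_mass (win_next m s : mmove R (act G P1))).
by rewrite card_bool.
Qed.

Section Receptive.
Context {pr : profile G} {sc : scheduler G} {s : state G} {r : run G}.
Hypothesis prw : pr P1 = win.
Hypothesis out : outcome s pr sc r.

Local Notation l k := (lc (rstate r k)).
Local Notation x k := (vx (rstate r k)).
Local Notation y k := (vy (rstate r k)).
Local Notation e k := (elapsed (rmove r k)).
Local Notation m k := (win_mem r k).
Let B k := blame P1 (rstate r k) (rmove r k) (rstate r k.+1).

Lemma win_move k : rmove r k P1 = win_next (m k) (rstate r k).
Proof.
by rewrite (outcome_pure out prw) plast_rprefix.
Qed.

Lemma win_blamed k : B k ->
  e k = (win_next (m k) (rstate r k)).1 /\
  (if l k then
     if 0 < x k then state_is (rstate r k.+1) busy 0 (y k + e k)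
     else if m k then state_is (rstate r k.+1) idle (x k + e k) 0
     else state_is (rstate r k.+1) busy (x k + e k) (y k + e k)
   else True).
Proof.
move=> Bk; have ee := blame_elapsed Bk; rewrite ee win_move; split=> //.
case: Bk => _ ->; rewrite win_move.
have av := win_next_avail (m k) (rstate r k); move: av; rewrite /win_next.
case: ifPn => // lk; case: ifPn => xk; first by move/trans_some.
case: ifPn => mk; first by move/trans_some.
by move=> /trans_none; rewrite lk.
Qed.

Lemma win_unblamed k : ~ B k ->
  e k <= (win_next (m k) (rstate r k)).1 /\
  if l k then
    state_is (rstate r k.+1) busy (x k + e k) (y k + e k) \/
    state_is (rstate r k.+1) idle (x k + e k) 0
  else
    state_is (rstate r k.+1) idle (x k + e k) (y k + e k) \/
    state_is (rstate r k.+1) busy 0 (y k + e k).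
Proof.
move=> nB; have [[//|bk]] := outcome_blame out k.
have ee := blame_elapsed bk; split.
  by rewrite -win_move /elapsed ge_min lexx.
rewrite ee; case: bk => _ ->; have := outcome_avail out k P2.
case: (rmove r k P2) => t [a|] av; last first.
  by have := trans_none av; case: (lc (rstate r k)); left.
have := trans_some av; move/avail2: av => [_]; case: a => /= [[-> _ _]|->]; by right.
Qed.

Lemma win_receptive_aux : ~ time_divergent r -> blameless P1 r.
Proof.
move=> nd; apply: contrapT => /infinite_often inf.
have e0 := outcome_elapsed out.
have ge k := state_ge0 (rstate r k); have lt k := @state_lt1 _ (rstate r k).
(* Small enough: when y < 1/8, the delay (1 - y)/2 exceeds 7/16, and the delay in [idle] is 2. *)
have e8 : 0 < 1 / 8 :> R by lra.
have [K hK] := not_divergent_tail e0 nd e8.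
have eK k : (K <= k)%N -> e k < 1 / 8.
  by move=> Kk; have := hK k k.+1 Kk; rewrite timeS; lra.
have mono := time_nondecreasing e0.
(* From "idle" with [y = 0], player 1 would have to wait more than 1/8 before it
   is blamed again. *)
have no_return k : (K <= k)%N -> ~ (l k = idle /\ y k = 0).
  move=> Kk [lk yk].
  (* Since round [k], [y] has grown at most with time; and in [busy] a set bit comes with [x > 0],
     so [win] never proposes [leave], its only move of small delay. *)
  pose J n := y n <= time r n - time r k /\ (l n = busy -> ~~ m n || (0 < x n)).
  apply: (@not_trapped B J k inf) => [n kn [yn mn]|]; last first.
    by split; [rewrite yk subrr|rewrite lk].
  have Kn := leq_trans Kk kn.
  have yn8 : y n < 1 / 8 by have := hK k n Kk; lra.
  have nB : ~ B n.
    move=> Bn; have [ee _] := win_blamed Bn; have := eK n Kn; rewrite ee /win_next.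
    case: ifPn => ln /=; last lra.
    case: ifPn => xn /=; first lra.
    by have := mn ln; rewrite (negPf xn) orbF => /negPf->; rewrite /=; lra.
  split=> //; have tn : time r k <= time r n by exact: mono.
  have [_] := win_unblamed nB; have en := e0 n; have [x0 y0] := ge n.
  rewrite /J win_memS /win_update timeS; case: ifPn => ln.
    case=> -[-> -> ->]; split=> //; try lra.
    move=> _; have := mn ln; case: (ltP 0 (x n)) => xn /=; last first.
      by rewrite orbF => /negPf->.
    by move=> _; lra.
  case=> -[-> -> ->]; split=> //; lra.
(* Without resets of [y], the blames of player 1 in "busy" occur in the order
   [x = 0] with the bit unset, [x > 0], [x = 0] with the bit set; the last one
   leads to "idle" with [y = 0]. *)
have ph2 k : (K <= k)%N -> ~ [/\ l k = busy, x k = 0 & m k].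
  move=> Kk; pose J n := [/\ l n = busy, x n = 0 & m n].
  apply: (@not_trapped B J k inf) => n kn [ln xn mn].
  have Kn : (K <= n.+1)%N by exact: leqW (leq_trans Kk kn).
  have nB : ~ B n.
    move=> Bn; have [_] := win_blamed Bn; rewrite ln xn ltxx mn => -[h1 _ h3].
    exact: (no_return _ Kn).
  split=> //; have [ee] := win_unblamed nB.
  (* Here [win] proposes delay 0, so player 2 can interpose only instantaneous rounds, which
     preserve [x = 0]. *)
  have {}ee : e n = 0.
    apply/le_anti; rewrite e0 andbT.
    by move: ee; rewrite /win_next ln xn ltxx mn.
  rewrite ln ee xn => -[[h1 h2 h3]|[h1 h2 h3]].
    by rewrite /J h1 h2 addr0 win_memS /win_update ln mn orbT.
  by case: (no_return _ Kn).
have ph1 k : (K <= k)%N -> ~ (l k = busy /\ 0 < x k).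
  move=> Kk; pose J n := l n = busy /\ 0 < x n.
  apply: (@not_trapped B J k inf) => n kn [ln xn].
  have Kn : (K <= n.+1)%N by exact: leqW (leq_trans Kk kn).
  have nB : ~ B n.
    move=> Bn; have [_] := win_blamed Bn; rewrite ln xn => -[h1 h2 h3].
    by apply: (ph2 _ Kn); rewrite win_memS /win_update ln xn.
  split=> //; have [_] := win_unblamed nB.
  rewrite ln => -[[h1 h2 h3]|[h1 h2 h3]]; last by case: (no_return _ Kn).
  by rewrite /J h1 h2; split=> //; have := e0 n; lra.
(* A blame beyond [K] can now only come from the wait at [x = 0] with the bit unset; this wait is
   positive and leads to [x > 0], which [ph1] excludes. *)
have [k Kk Bk] := inf K.
have Kn : (K <= k.+1)%N by exact: leqW.
have [ee] := win_blamed Bk; move: ee; rewrite /win_next.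
case: ifPn => lk; last by move=> /= ee; have := eK k Kk; lra.
case: ifPn => xk; first by case: (ph1 _ Kk).
have xk0 : x k = 0 by apply/le_anti; rewrite (ge k).1 leNgt xk.
case: ifPn => mk; first by case: (ph2 _ Kk).
move=> /= ee [h1 h2 _]; apply: (ph1 _ Kn); rewrite h1 h2; split=> //.
by have := lt k lk; lra.
Qed.

End Receptive.

Lemma win_receptive : receptive win.
Proof.
move=> pr sc s r prw out; have [|nd] := pselect (time_divergent r).
  by left.
by right; apply: win_receptive_aux prw out nd.
Qed.

End Win.

(** * Invariance of [win] under region equivalence *)

Section Regions.
Context {R : realType}.

Local Notation G := (agame (@arena R)).
Local Notation conf := (loc (@arena R) * {ffun clock (@arena R) -> R})%type.

(** The list of constants is nonempty, so the default 1 does not apply. Regions see of [x] only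
    whether it is positive. *)
Lemma cmax_x : cmax (A := @arena R) cx = 0%N.
Proof.
have E : all_consts (A := @arena R) cx = [:: 0%N].
  by rewrite /all_consts enumT unlock.
by rewrite /cmax E big_seq1.
Qed.

Lemma cmax_y : cmax (A := @arena R) cy = 1%N.
Proof.
have E : all_consts (A := @arena R) cy = [:: 0%N; 1%N].
  by rewrite /all_consts enumT unlock.
by rewrite /cmax E !big_cons big_nil.
Qed.

Lemma frac_unit (t : R) : 0 <= t < 1 -> Num.floor t = 0 /\ Defs.frac t = t.
Proof.
move=> h; have f0 : Num.floor t = 0 by apply: floor_def; rewrite add0r.
by rewrite /Defs.frac f0 subr0.
Qed.

(** Each clock is beyond its constant, or [x] is 0, or [y] is strictly between 0 and 1; this
    determines the order of the relevant fractional parts. *)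
Lemma arena_region_eq (q q' : conf) : q.1 = q'.1 ->
  0 <= q.2 cx -> 0 <= q'.2 cx -> (0 < q.2 cx) = (0 < q'.2 cx) ->
  (0 < q.2 cy < 1 /\ 0 < q'.2 cy < 1) \/ (1 < q.2 cy /\ 1 < q'.2 cy) ->
  region_eq (A := arena) q q'.
Proof.
move=> h1 x0 x0' hx hy.
have zero (z : conf) : 0 <= z.2 cx -> z.2 cx <= 0 -> z.2 cx = 0.
  by move=> a b; apply/le_anti; rewrite a b.
have gt1 : (1 < q.2 cy) = (1 < q'.2 cy) by case: hy; lra.
have le x : (q.2 x <= (cmax x)%:R) = (q'.2 x <= (cmax x)%:R).
  by rewrite !leNgt; case: x; rewrite ?cmax_x ?cmax_y ?hx ?gt1.
have [|f0 fr0] := @frac_unit 0; first lra.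
have eqx : q.2 cx <= (cmax (A := @arena R) cx)%:R -> q.2 cx = 0 /\ q'.2 cx = 0.
  move=> h; have := h; rewrite le; move: h; rewrite cmax_x => a b.
  by split; exact: zero.
have eqy : q.2 cy <= (cmax (A := @arena R) cy)%:R ->
    0 < q.2 cy < 1 /\ 0 < q'.2 cy < 1.
  by rewrite cmax_y => a; case: hy => // -[]; lra.
split=> //.
- by move=> x; rewrite !ltNge le.
- case.
    by move=> /eqx[-> ->].
  move=> /eqy[a b].
  have [|-> ->] := @frac_unit (q.2 cy); first lra.
  have [|-> ->] := @frac_unit (q'.2 cy); first lra.
  by split=> //; lra.
case; case; move=> a b.
- by move: a => /eqx[-> ->].
- have [-> ->] := eqx a; have [c d] := eqy b.
  have [|_ ->] := @frac_unit (q.2 cy); first lra.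
  have [|_ ->] := @frac_unit (q'.2 cy); first lra.
  by rewrite fr0; lra.
- have [-> ->] := eqx b; have [c d] := eqy a.
  have [|_ ->] := @frac_unit (q.2 cy); first lra.
  have [|_ ->] := @frac_unit (q'.2 cy); first lra.
  by rewrite fr0; lra.
- by rewrite !lexx.
Qed.

Lemma region_eq_lc (s s' : state G) : region_eq (A := arena) (val s) (val s') ->
  lc s = lc s' /\ (0 < vx s) = (0 < vx s').
Proof. by case=> h1 /(_ cx); rewrite cmax_x. Qed.

(** [win_update] reads only the location and the sign of [x], both of which are constant on
    regions. *)
Lemma prefix_eq_memory m (s s' : state G) w w' :
  region_eq (A := arena) (val s) (val s') -> steps_eq (A := arena) s s' w w' ->
  memory (G := G) win_update m s w = memory (G := G) win_update m s' w' /\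
  region_eq (A := arena) (val (plast (G := G) (s, w)))
    (val (plast (G := G) (s', w'))).
Proof.
elim: w w' m s s' => [|[mv t] w IH] [|[mv' t'] w'] m s s' //= h [_ ht hw].
have [hl hx] := region_eq_lc h.
rewrite /win_update hl hx; exact: IH.
Qed.

(** The delays may differ, but they land alike: with [x > 0] and 0 < y < 1 after a positive wait in
    [busy], with [x > 0] and y > 1 in [idle]; [leave] has delay 0. *)
Lemma wait_region m (s s' : state G) :
  region_eq (A := arena) (val s) (val s') ->
  region_eq (A := arena) (wait (val s) (win_next m s).1)
    (wait (val s') (win_next m s').1) /\
  (win_next m s).2 = (win_next m s').2.
Proof.
move=> h; have [hl hx] := region_eq_lc h.
have [x0 y0] := state_ge0 s; have [x0' y0'] := state_ge0 s'.
have y1 := @state_lt1 _ s; have y1' := @state_lt1 _ s'.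
have [e1 _ _ _] := h.
rewrite /win_next -hl -hx.
case: ifPn => l; last first.
  split=> //; apply: arena_region_eq;
    rewrite //= !ffunE -/(vx s) -/(vx s') -/(vy s) -/(vy s');
  [lra|lra| |right; lra].
  by rewrite !ltr_wpDl.
have {}y1 := y1 l; rewrite -hl in y1'; have {}y1' := y1' l.
case: ifPn => x /=.
  split=> //; apply: arena_region_eq;
    rewrite //= !ffunE -/(vx s) -/(vx s') -/(vy s) -/(vy s');
  [lra|lra| |left; lra].
  by rewrite hx in x; lra.
case: ifPn => _ /=.
  by split=> //; rewrite !wait0.
split=> //; apply: arena_region_eq;
    rewrite //= !ffunE -/(vx s) -/(vx s') -/(vy s) -/(vy s');
  [lra|lra| |left; lra].
by rewrite !ltr_wpDl //; lra.
Qed.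

Lemma win_region : region_strategy (A := @arena R) (win (R := R)).
Proof.
move=> p p' vp vp' [h0 hs] a Q [q _ ->].
have [hm hl] := @prefix_eq_memory false p.1 p'.1 p.2 p'.2 h0 hs.
rewrite /= !diracE hm; congr (_%:R%:E); congr nat_of_bool.
move: hl; rewrite -!surjective_pairing => hl.
have [hw h2] := @wait_region (memory (G := G) win_update false p'.1 p'.2) _ _ hl.
have st z n : is_state (wait (val z) (@win_next R n z).1).
  by have [/= t0 + _] := win_next_avail n z; apply; rewrite lexx t0.
apply/idP/idP; rewrite !inE => -[ha [_ hr]]; split.
- by rewrite -h2.
- by split; [exact: st|exact: region_eq_trans hw].
- by rewrite h2.
- by split; [exact: st|exact: region_eq_trans (region_eq_sym hw)].
Qed.

End Regions.

(** * Memoryless region strategies *)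

Section Spoiling.
Context {R : realType}.
Local Notation G := (agame (@arena R)).

Definition flee (s : state G) : move R (act G P2) :=
  if lc s then (0, Some eject) else (2, None).

Lemma flee_avail s : avail P2 s (flee s).
Proof.
rewrite /flee; case: ifPn => l.
  apply/avail2; split=> //; apply/avail_delay; split=> // _.
  by rewrite addr0; exact: state_lt1.
by apply/avail_delay; split=> [|l']; [lra|rewrite l' in l].
Qed.

Definition fleeing : strategy G P2 :=
  pure_strategy (fun p => flee_avail (plast p)).

(** When less than one time unit remains, the delay 2 in [idle] is never completed, so blame can
    fall only in [busy]. Such a blame ejects to [idle], where player 1 can only wait and [fleeing]
    never plays [back]. *)
Lemma fleeing_receptive : receptive fleeing.
Proof.
move=> pr sc s r prf out; have [|nd] := pselect (time_divergent r).
  by left.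
right; apply: contrapT => /infinite_often inf.
have e0 := outcome_elapsed out.
have [K hK] := not_divergent_tail e0 nd ltr01.
have move2 k : rmove r k P2 = flee (rstate r k).
  by rewrite (outcome_pure out prf) plast_rprefix.
have busy_blamed k : (K <= k)%N ->
    blame P2 (rstate r k) (rmove r k) (rstate r k.+1) -> lc (rstate r k).
  move=> Kk /blame_elapsed; rewrite move2 /flee; case: ifP => // _ /= ek.
  by have := hK k k.+1 Kk; rewrite timeS ek; lra.
have [k Kk Bk] := inf K.
have lk := busy_blamed k Kk Bk.
apply: (@not_trapped _ (fun n => lc (rstate r n) = idle) k.+1 inf) => [n kn ln|].
  have nB : ~ blame P2 (rstate r n) (rmove r n) (rstate r n.+1).
    by move/(busy_blamed _ (leq_trans Kk (ltnW kn))); rewrite ln.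
  split=> //; have [[[_ ->]|//]] := outcome_blame out n.
  have := outcome_avail out n P1; case: (rmove r n P1) => t [a|] av.
    by have [_] := (avail1 _ _ _).1 av; rewrite ln.
  by have [-> _ _] := trans_none av.
have [_ ->] := Bk; rewrite move2; have := flee_avail (rstate r k).
by rewrite /flee lk => /trans_some[].
Qed.

(** The bound y < 1 comes from the invariant of [busy], so all these states lie in one region. *)
Definition hub (s : state G) := [/\ lc s = busy, vx s = 0 & 0 < vy s].

(** * Spoiling runs against a memoryless strategy *)

Section Memoryless.
Context { pi : strategy G P1 } {f : state G -> move R (act G P1)}.
Context {rule : state G -> dist R (act G P1)}.
Hypothesis pi_rule : forall p, valid_prefix p -> pi p = rule (plast p).
Hypothesis f_supp : forall s, dsupp (rule s) (f s : mmove R (act G P1)).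

Lemma f_avail s : avail P1 s (f s).
Proof.
have vs : valid_prefix ((s, [::]) : Defs.prefix G) by [].
have := @choice_avail _ _ _ pi _ vs.
by rewrite pi_rule //; apply; exact: f_supp.
Qed.

(** In "idle", player 2 cuts short any positive delay of player 1; elsewhere it
    proposes the delay of player 1, and the scheduler favours player 1.  The
    fallback [(0, None)] matters only in states that [spoil_run] does not visit
    when it starts in a hub state. *)
Definition spoil (k : nat) (s : state G) : move R (act G P2) :=
  let m : move R (act G P2) :=
    if ~~ lc s && (0 < (f s).1)
    then (Num.min (f s).1 ((1/2) ^+ k) / 2, Some back)
    else ((f s).1, None) in
  if `[< avail P2 s m >] then m else (0, None).

Lemma spoil_avail k s : avail P2 s (spoil k s).
Proof. by rewrite /spoil; case: asboolP => // _; exact: avail_bot. Qed.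

Definition spoiling : strategy G P2 :=
  pure_strategy (fun p => spoil_avail (size p.2) (plast p)).

Definition spoil_joint k s : joint G :=
  fun i => match i with P1 => f s | P2 => spoil k s end.

(** The constant scheduler ignores its prefix, so the dummy [(s, [::])] gives the same winner as the
    true one. *)
Definition spoil_next k s : state G :=
  let m := spoil_joint k s in
  let w := winner (fun _ _ => P1) (s, [::]) m in trans w s (m w).

Fixpoint spoil_state s k : state G :=
  if k is k'.+1 then spoil_next k' (spoil_state s k') else s.

Definition spoil_run s : run G :=
  Run (spoil_state s) (fun k => spoil_joint k (spoil_state s k)).

Definition spoil_profile : profile G :=
  fun i => match i with P1 => pi | P2 => spoiling end.

Lemma spoil_valid s k : valid_prefix (rprefix (spoil_run s) k).
Proof.
elim: k => [//|k IH]; rewrite rprefixS; apply: valid_prefix_rcons => //.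
- by rewrite plast_rprefix; case; [exact: f_avail|exact: spoil_avail].
- by rewrite plast_rprefix; eexists; exact: winner_blame.
Qed.

(** An outcome only asks that moves lie in the supports. Playing the selection [f] throughout is
    therefore an outcome of the randomized [pi], even if it has probability 0. *)
Lemma spoil_outcome s :
  outcome s spoil_profile (fun _ _ => P1) (spoil_run s).
Proof.
split=> // k; split=> [] //.
case=> /=; first by rewrite pi_rule ?plast_rprefix //; exact: spoil_valid.
by rewrite plast_rprefix /= size_map size_iota.
Qed.

Lemma spoil_copy k s : lc s || ((f s).1 == 0) ->
  elapsed (spoil_joint k s) = (f s).1 /\ spoil_next k s = trans P1 s (f s).
Proof.
move=> h; have sp : spoil k s = ((f s).1, None).
  rewrite /spoil; have -> : ~~ lc s && (0 < (f s).1) = false.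
    by apply/negbTE; move: h; case: (lc s) => //= /eqP->; rewrite ltxx.
  case: asboolP => // -[]; apply: (@avail_opp _ P1).
  exact: avail_weak (f_avail s).
rewrite /elapsed /spoil_next /winner /= sp /=.
by rewrite minxx ltxx.
Qed.

(** The halved minimum is below the delay of player 1, so player 2 wins the round; below 1, so
    [back] respects the invariant; and summable over [k]. *)
Lemma spoil_back k s : lc s = idle -> vy s = 0 -> 0 < (f s).1 ->
  let t := Num.min (f s).1 ((1/2) ^+ k) / 2 in
  [/\ 0 < t <= (1/2) ^+ k / 2, elapsed (spoil_joint k s) = t &
      state_is (spoil_next k s) busy 0 t].
Proof.
move=> ls ys f0 t.
have k0 : 0 < (1/2) ^+ k :> R by apply: exprn_gt0; lra.
have k1 : (1/2) ^+ k <= 1 :> R by apply: exprn_ile1; lra.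
have m0 : 0 < Num.min (f s).1 ((1/2) ^+ k) by rewrite lt_min f0.
have mf : Num.min (f s).1 ((1/2) ^+ k) <= (f s).1 by rewrite ge_min lexx.
have mk : Num.min (f s).1 ((1/2) ^+ k) <= (1/2) ^+ k.
  by rewrite ge_min lexx orbT.
have t0 : 0 < t by rewrite /t; lra.
have tf : t < (f s).1 by rewrite /t; lra.
have av : avail P2 s (t, Some back).
  apply/avail2; split.
    by apply/avail_delay; split; [exact: ltW|rewrite ls].
  by rewrite ys add0r; split=> //; rewrite /t; lra.
have sp : spoil k s = (t, Some back).
  by rewrite /spoil ls f0 /= -/t; case: asboolP.
split; first by rewrite /t; lra.
  by rewrite /elapsed /= sp /=; apply/min_idPr; exact: ltW.
rewrite /spoil_next /winner /= sp /= ltNge (ltW tf) /= tf /=.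
have := trans_some av; rewrite ys add0r -sp; exact.
Qed.

(** The run never leaves [busy] and [y] is never reset, so time stays below 1, while every tie puts
    blame on player 1. *)
Lemma not_receptive_of_not_leave (s : state G) : hub s ->
  (forall s, hub s -> f s <> (0, Some leave)) -> ~ receptive pi.
Proof.
move=> [ls xs ys] nl rec.
have out := spoil_outcome s; have nav := @f_avail.
have copy k : lc (spoil_state s k) ->
    elapsed (rmove (spoil_run s) k) = (f (spoil_state s k)).1 /\
    spoil_state s k.+1 = trans P1 (spoil_state s k) (f (spoil_state s k)).
  by move=> lk; apply: spoil_copy; rewrite lk.
have e0 := outcome_elapsed out.
have inv k : lc (spoil_state s k) /\
    vy s + time (spoil_run s) k = vy (spoil_state s k).
  elim: k => [|k [lk yk]]; first by rewrite /time big_ord0 addr0.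
  have tk : 0 <= time (spoil_run s) k.
    by have := time_nondecreasing e0 (leq0n k); rewrite {1}/time big_ord0.
  have [ek ->] := copy k lk; rewrite timeS addrA yk ek.
  have := nav (spoil_state s k); case fk: (f _) => [t [[]|]] av /=.
  - by have [-> _ ->] := trans_some av.
  (* [leave] forces both [x] and the delay to be 0; [y] started positive and has only grown, so this
     is a hub state, where [nl] forbids the move. *)
  - have [av0 _ xt] := (avail1 _ _ _).1 av.
    have [t0 _] := (avail_delay _ _ _).1 av0.
    have [x0 _] := state_ge0 (spoil_state s k).
    have {}xt := xt erefl.
    case: (nl (spoil_state s k)); first by split=> //; lra.
    by rewrite fk; congr (_, _); lra.
  - by have [-> _ ->] := trans_none av.
have [td|] := rec _ _ _ _ erefl out.
  apply: (bounded_not_divergent (c := 1)) td => k.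
  have [lk yk] := inv k; have := @state_lt1 _ _ lk; lra.
apply: recurrent_infinite => k; left; have [lk _] := inv k.
have [ek nk] := copy k lk.
by split=> //=; have := elapsed_le (rmove (spoil_run s) k) P2; rewrite ek.
Qed.

(** The run moves between hub states and [idle] with [y = 0]. A round that does not blame player 1
    ends in a hub state, where player 1 leaves at once and is blamed. *)
Lemma not_receptive_of_leave (s : state G) : hub s ->
  (forall s, hub s -> f s = (0, Some leave)) -> ~ receptive pi.
Proof.
move=> hs fl rec.
have out := spoil_outcome s.
pose J k := hub (spoil_state s k) \/
  lc (spoil_state s k) = idle /\ vy (spoil_state s k) = 0.
have step k : J k -> [/\ J k.+1,
    elapsed (rmove (spoil_run s) k) <= (1/2) ^+ k / 2 &
    blame P1 (spoil_state s k) (rmove (spoil_run s) k) (spoil_state s k.+1) \/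
    hub (spoil_state s k.+1)].
  have k0 : 0 < (1/2) ^+ k :> R by apply: exprn_gt0; lra.
  case=> [hk|[lk yk]].
    have [lk xk yk] := hk; have fk := fl _ hk.
    have [|ek nk] := @spoil_copy k (spoil_state s k); first by rewrite lk.
    have av := f_avail (spoil_state s k).
    split.
    - right => /=; rewrite nk; move: av; rewrite fk => av.
      by have [-> _ ->] := trans_some av.
    - by rewrite [elapsed _]ek fk /=; lra.
    left; split=> //=; have := elapsed_le (spoil_joint k (spoil_state s k)) P2.
    by rewrite ek.
  have av := f_avail (spoil_state s k).
  have [t0 _] := (avail_delay _ _ _).1 (avail_weak av).
  have [fp|fn] := ltP 0 (f (spoil_state s k)).1.
    have [tk ek [h1 h2 h3]] := spoil_back k lk yk fp.
    have hk1 : hub (spoil_state s k.+1) by split=> //=; rewrite h3; lra.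
    by split; [left|rewrite [elapsed _]ek; lra|right].
  have f0 : (f (spoil_state s k)).1 = 0 by apply/le_anti; rewrite fn.
  have [|ek nk] := @spoil_copy k (spoil_state s k).
    by rewrite f0 eqxx orbT.
  split.
  - right => /=; rewrite nk; move: av f0; case: (f _) => t [a|] av /= f0.
      by have [_] := (avail1 _ _ _).1 av; rewrite lk.
    by have [-> _ ->] := trans_none av; rewrite lk yk f0 addr0.
  - by rewrite [elapsed _]ek f0; lra.
  left; split=> //=; have := elapsed_le (spoil_joint k (spoil_state s k)) P2.
  by rewrite ek.
have inv k : J k by elim: k => [|k /step[]//]; left.
have [td|] := rec _ _ _ _ erefl out.
  apply: (bounded_not_divergent (c := 1)) td => k.
  (* The unspent geometric budget is added to make the bound inductive. *)
  have : time (spoil_run s) k + (1/2) ^+ k <= 1.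
    elim: k => [|k IH]; first by rewrite /time big_ord0 expr0 add0r.
    by have [_ ek _] := step k (inv k); rewrite timeS exprS; lra.
  have : 0 < (1/2) ^+ k :> R by apply: exprn_gt0; lra.
  lra.
apply: recurrent_infinite => k /=.
have [_ _ [|hk]] := step k (inv k); first by left.
right; have [lk xk yk] := hk; have fk := fl _ hk.
have [|ek nk] := @spoil_copy k.+1 (spoil_state s k.+1); first by rewrite lk.
split=> //=; have := elapsed_le (spoil_joint k.+1 (spoil_state s k.+1)) P2.
by rewrite ek.
Qed.

End Memoryless.

(** Landing where [x = 0] forces delay 0. The region condition, stated for landing sets, thereby
    controls the probability of one single move. *)
Lemma leave_landing (s : state G) q : hub s ->
  region_eq (A := arena) q (val s) ->
  landing (s : astate arena) (Some leave : option (action arena P1))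
    (region (A := arena) q) =
  [set (0, Some leave)].
Proof.
move=> [ls xs ys] hq.
apply/seteqP; split=> [[t a] [/= -> [st hr]]|[t a] [-> ->]] /=.
  have [_ /(_ cx) + _ _] := region_eq_trans (region_eq_sym hq) hr.
  move: st; rewrite is_stateE cmax_x /= !ffunE -/(vx s) xs ltxx.
  move=> /and3P[x0 _ _] /esym /negbT.
  by rewrite -leNgt => x1; congr (_, _); lra.
by split=> //=; rewrite wait0; split=> //; exact: (valP s).
Qed.

Lemma hub_region_eq (s s' : state G) : hub s -> hub s' ->
  region_eq (A := arena) (val s) (val s').
Proof.
move=> [ls xs ys] [ls' xs' ys'].
have y1 := @state_lt1 _ s ls; have y1' := @state_lt1 _ s' ls'.
apply: arena_region_eq; rewrite -/(vx s) -/(vx s') ?xs ?xs' //.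
  by rewrite -/(lc s) -/(lc s') ls.
by left; rewrite -/(vy s) -/(vy s'); split; lra.
Qed.

Lemma hub_exists : exists s, hub s.
Proof.
pose q : loc (@arena R) * {ffun clock (@arena R) -> R} :=
  (busy, [ffun c => if c == cx then 0 else 1 / 2]).
have st : is_state q by rewrite is_stateE !ffunE /=; lra.
exists (exist _ q st : astate arena).
by split=> //; rewrite /vx /vy /= ffunE //=; lra.
Qed.

(** The probability of leaving at once is the same in all hub states. If it is positive, [f] can
    select this move in each of them; if it is 0, [f] can avoid it in each of them. Both selections
    give a bad run. *)
Lemma memoryless_not_receptive (pi : strategy G P1) :
  memoryless pi -> region_strategy (A := arena) pi -> ~ receptive pi.
Proof.
move=> [M [m0 [u [next [M1 hpi]]]]] reg.
have Mm (a b : M) : a = b by exact: (fintype_le1P (eq_leq M1)).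
have pi_rule p : valid_prefix p -> pi p = next m0 (plast p).
  by move=> /hpi->; congr next; exact: Mm.
have [h hh] := hub_exists.
pose L : set (mmove R (act G P1)) := [set (0, Some leave)].
have mL : measurable L by exact: measurable_move1.
have prL s : hub s -> dprob (next m0 s) L = dprob (next m0 h) L.
  move=> hs; have vs : valid_prefix (s, [::] : seq (joint G * state G)) by [].
  have vh : valid_prefix (h, [::] : seq (joint G * state G)) by [].
  have := reg _ _ vs vh (conj (hub_region_eq hs hh) I) (Some leave)
    (region (A := arena) (val h)).
  move=> /(_ (ex_intro2 _ _ (val h) (valP h) erefl)).
  rewrite /plast /= !leave_landing //; last exact: hub_region_eq.
  by rewrite !pi_rule.
have [L0|L0] := pselect ((0 < dprob (next m0 h) L)%E).
  have sel s : exists m, dsupp (next m0 s) m /\ (hub s -> m = (0, Some leave)).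
    have [hs|nhs] := pselect (hub s).
      have [|m mD mL'] := @dist_meet _ _ (next m0 s) L mL; first by rewrite prL.
      by exists m.
    have [|m mD _] := @dist_meet _ _ (next m0 s) setT measurableT.
      by rewrite probability_setT lte01.
    by exists m.
  have [f hf] := choice sel.
  apply: (@not_receptive_of_leave pi f (next m0) pi_rule _ h hh) => s.
  by case: (hf s).
  by case: (hf s).
have sel s : exists m, dsupp (next m0 s) m /\ (hub s -> m <> (0, Some leave)).
  have [hs|nhs] := pselect (hub s).
    have [||m mD mL'] := @dist_meet _ _ (next m0 s) (~` L).
    - exact: measurableC.
    - rewrite probability_setC // prL //.
      have -> : dprob (next m0 h) L = 0%E.
        by apply/le_anti; rewrite measure_ge0 andbT leNgt; apply/negP.
      by rewrite sube0 lte01.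
    by exists m.
  have [|m mD _] := @dist_meet _ _ (next m0 s) setT measurableT.
    by rewrite probability_setT lte01.
  by exists m.
have [f hf] := choice sel.
apply: (@not_receptive_of_not_leave pi f (next m0) pi_rule _ h hh) => s.
  by case: (hf s).
by case: (hf s).
Qed.

End Spoiling.

Theorem theorem3 (R : realType) :
  exists (A : automaton R) (Y : set (state (agame A))) (s : state (agame A)),
    well_formed (agame A) /\
    region_union Y /\
    ~ (exists pi : strategy (agame A) P1,
         memoryless pi /\ region_strategy pi /\ sure_winning s (safe Y) pi) /\
    (exists pi : strategy (agame A) P1,
       (exists2 n : nat, (n <= #|clock A|.+1)%N & has_memory n pi) /\
       region_strategy pi /\ sure_winning s (safe Y) pi).
Proof.
(* Any state serves as [s]: memoryless region strategies already fail receptiveness, which does not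
   refer to it. *)
have [s _] := @hub_exists R.
exists arena, setT, s; split.
  case; first by exists win; exact: win_receptive.
  by exists fleeing; exact: fleeing_receptive.
split; first exact: setT_region_union.
split.
  by move=> [pi [ml [reg [rec _]]]]; exact: memoryless_not_receptive ml reg rec.
exists win; split; first by exists 2%N; [rewrite card_bool|exact: win_memory].
split; first exact: win_region.
by split; [exact: win_receptive|].
Qed.
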